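(* For $\gamma,\omega\in\mathbb R$ let $\sigma_{\gamma,\omega}$ be the spectrum of $Q_{\gamma,\omega}$. For all $\gamma,\omega,e\in\mathbb R$: $$\sigma_{\gamma,\omega}\subset[-4,4],\qquad \sigma_{\gamma+16\pi,\omega}=\sigma_{\gamma,\omega},\qquad e\in\sigma_{\gamma+8\pi,\omega}\Leftrightarrow -e\in\sigma_{\gamma,\omega}.$$ When $\omega=0$: $$\sigma_{-\gamma,0}=\sigma_{\gamma,0},\qquad e\in\sigma_{8\pi-\gamma,0}\Leftrightarrow -e\in\sigma_{\gamma,0}.$$ When $\omega=\pi/8$: $$\sigma_{6\pi-\gamma,\frac\pi8}=\sigma_{\gamma,\frac\pi8},\qquad e\in\sigma_{-2\pi-\gamma,\frac\pi8}\Leftrightarrow -e\in\sigma_{\gamma,\frac\pi8}.$$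
   Context: On $\ell^2(\mathbb Z^2;\mathbb C)$ let $(\tau_1v)_\alpha=v_{\alpha_1-1,\alpha_2}$, $(\tau_2v)_\alpha=e^{i\gamma\alpha_1}v_{\alpha_1,\alpha_2-1}$. For $\gamma,\omega\in\mathbb R$, acting on $\ell^2(\mathbb Z^2;\mathbb C^3)$, $$Q_{\gamma,\omega}=\begin{pmatrix}0&e^{i(\omega+\frac\gamma8)}(\tau_1^*+e^{-i\frac\gamma2}\tau_1^*\tau_2)&e^{-i(\omega+\frac\gamma8)}(\tau_1^*+\tau_2^* )\\ e^{-i(\omega+\frac\gamma8)}(\tau_1+e^{-i\frac\gamma2}\tau_1\tau_2^* )&0&e^{i(\omega+\frac\gamma8)}(e^{-i\frac\gamma2}\tau_1\tau_2^*+\tau_2^* )\\ e^{i(\omega+\frac\gamma8)}(\tau_1+\tau_2)&e^{-i(\omega+\frac\gamma8)}(e^{-i\frac\gamma2}\tau_1^*\tau_2+\tau_2)&0\end{pmatrix}.$$ *)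

(* Defs.v *)
From HB Require Import structures.
From mathcomp Require Import all_boot all_order all_algebra finmap.
From mathcomp Require Import complex ring lra.
From mathcomp Require Import all_classical all_reals all_analysis.
From mathcomp Require summability.

Set Implicit Arguments.
Unset Strict Implicit.
Unset Printing Implicit Defensive.

Import Order.TTheory GRing.Theory Num.Theory.
Import numFieldNormedType.Exports.

Local Open Scope classical_set_scope.
Local Open Scope ring_scope.

Section square_summable.
Variables (R : realType) (X : choiceType).
Implicit Types (u v : X -> R[i]^o) (y z : R[i]).

Definition normsq z : R := complex.Re z ^+ 2 + complex.Im z ^+ 2.

Definition sumsq v : \bar R := \esum_(a in [set: X]) (normsq (v a))%:E.

Definition square_summable : {pred X -> R[i]^o} :=
  mem [set v | (sumsq v < +oo)%E].

Lemma normsq_ge0 z : 0 <= normsq z.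
Proof. by rewrite addr_ge0// sqr_ge0. Qed.

Lemma normsqM y z : normsq (y * z) = normsq y * normsq z.
Proof. by case: y z => [a b] [c d]; rewrite /normsq /=; ring. Qed.

Lemma normsq_eq0 z : normsq z = 0 -> z = 0.
Proof.
case: z => [a b] /eqP; rewrite paddr_eq0 ?sqr_ge0//= !sqrf_eq0.
by move=> /andP[/eqP-> /eqP->].
Qed.

Lemma normsqE z : (normsq z)%:C%C = `|z| ^+ 2.
Proof.
case: z => [a b]; rewrite -[X in X ^+ 2]/((Num.sqrt (a ^+ 2 + b ^+ 2))%:C%C).
by rewrite -rmorphXn /= sqr_sqrtr// addr_ge0// sqr_ge0.
Qed.

Lemma normsqD y z (t : R) : 0 < t ->
  normsq (y + z) <= (1 + t) * normsq y + (1 + t^-1) * normsq z.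
Proof.
move=> t0.
have key (a b : R) : (a + b) ^+ 2 <= (1 + t) * a ^+ 2 + (1 + t^-1) * b ^+ 2.
  rewrite -subr_ge0.
  have -> : (1 + t) * a ^+ 2 + (1 + t^-1) * b ^+ 2 - (a + b) ^+ 2 =
            t^-1 * (t * a - b) ^+ 2 by field; rewrite gt_eqF.
  by rewrite mulr_ge0 ?sqr_ge0// invr_ge0 ltW.
case: y z => [a b] [c d]; rewrite /normsq /=.
by have := key a c; have := key b d; lra.
Qed.

Lemma sumsq_ge0 v : (0 <= sumsq v)%E.
Proof. by apply: esum_ge0 => a _; rewrite lee_fin normsq_ge0. Qed.

Lemma sumsq_term v a : ((normsq (v a))%:E <= sumsq v)%E.
Proof.
apply: esum_ge; exists [set a]; first by split.
by rewrite fsbig_set1.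
Qed.

Lemma esumZl (c : R) (f : X -> R) : 0 <= c -> (forall a, 0 <= f a) ->
  (\esum_(a in [set: X]) (c * f a)%:E =
   c%:E * \esum_(a in [set: X]) (f a)%:E)%E.
Proof.
move=> c0 f0; have [->|cn0] := eqVneq c 0.
  by rewrite mul0e esum1// => a _; rewrite mul0r.
have cp : 0 < c by rewrite lt_def cn0.
have le_Z (d : R) (g : X -> R) : 0 < d -> (forall a, 0 <= g a) ->
    (\esum_(a in [set: X]) (d * g a)%:E <=
     d%:E * \esum_(a in [set: X]) (g a)%:E)%E.
  move=> d0 g0; apply: ge_ereal_sup => _ [A [finA _] <-].
  rewrite (eq_fsbigr (fun a => d%:E * (g a)%:E)%E); last by move=> a _; rewrite EFinM.
  rewrite -ge0_mule_fsumr; last by move=> a; rewrite lee_fin.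
  rewrite lee_pmul2l ?fin_numE//.
  by apply: esum_ge; exists A.
apply/eqP; rewrite eq_le le_Z//= -lee_pdivlMl//.
have := le_Z c^-1 (fun a => c * f a).
rewrite invr_gt0 => /(_ cp (fun a => mulr_ge0 c0 (f0 a))).
by under eq_esum => a _ do rewrite mulKf//.
Qed.

Lemma sumsqZ (c : R[i]) v : sumsq (c *: v) = ((normsq c)%:E * sumsq v)%E.
Proof.
rewrite -esumZl ?normsq_ge0//; last by move=> a; exact: normsq_ge0.
by apply: eq_esum => a _; rewrite -normsqM.
Qed.

Lemma sumsqD u v (t : R) : 0 < t ->
  (sumsq (u + v)%R <= (1 + t)%:E * sumsq u + (1 + t^-1)%:E * sumsq v)%E.
Proof.
move=> t0; have t1 : 0 <= 1 + t by rewrite addr_ge0// ltW.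
have t2 : 0 <= 1 + t^-1 by rewrite addr_ge0// invr_ge0 ltW.
rewrite -!esumZl//; try by move=> a; exact: normsq_ge0.
rewrite -esumD.
- by apply: le_esum => a _; rewrite -EFinD lee_fin normsqD.
- by move=> a _; rewrite lee_fin mulr_ge0 ?normsq_ge0.
- by move=> a _; rewrite lee_fin mulr_ge0 ?normsq_ge0.
Qed.

Lemma square_summable_submod_closed : submod_closed square_summable.
Proof.
split=> [|c u v]; rewrite !inE /=.
  rewrite /sumsq esum1// => a _.
  by rewrite /normsq /= expr0n /= addr0.
move=> uoo voo; apply: le_lt_trans (sumsqD _ _ ltr01) _.
rewrite sumsqZ lte_add_pinfty// !lte_mul_pinfty// ?lee_fin ?normsq_ge0//.
Qed.

HB.instance Definition _ := GRing.isSubmodClosed.Build _ _ square_summable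
  square_summable_submod_closed.

(* The Hilbert space of square-summable families, as a normed space: the norm
   takes its (real, nonnegative) values in R[i], as [normedModType R[i]]
   requires. *)
Record l2 := L2 { l2_val :> X -> R[i]^o; l2_valP : l2_val \in square_summable }.

HB.instance Definition _ := [isSub for l2_val].
HB.instance Definition _ := [Choice of l2 by <:].
HB.instance Definition _ := [SubChoice_isSubLmodule of l2 by <:].

Implicit Types f g : l2.

Definition l2_norm f : R[i] := (Num.sqrt (fine (sumsq f)))%:C%C.

Lemma l2_sumsq_fin f : sumsq f \is a fin_num.
Proof.
by rewrite ge0_fin_numE ?sumsq_ge0//; have := l2_valP f; rewrite inE.
Qed.

Lemma l2_normD f g : l2_norm (f + g) <= l2_norm f + l2_norm g.
Proof.
rewrite /l2_norm -rmorphD lecR.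
have H (t : R) : 0 < t -> fine (sumsq (f + g)) <=
    (1 + t) * fine (sumsq f) + (1 + t^-1) * fine (sumsq g).
  move=> t0; rewrite -lee_fin EFinD !EFinM !fineK ?l2_sumsq_fin//.
  exact: sumsqD.
set x := Num.sqrt (fine (sumsq f)); set y := Num.sqrt (fine (sumsq g)).
have fE : fine (sumsq f) = x ^+ 2 by rewrite sqr_sqrtr// fine_ge0// sumsq_ge0.
have gE : fine (sumsq g) = y ^+ 2 by rewrite sqr_sqrtr// fine_ge0// sumsq_ge0.
have x0 : 0 <= x by exact: sqrtr_ge0.
have y0 : 0 <= y by exact: sqrtr_ge0.
rewrite -[leRHS]ger0_norm ?addr_ge0// -sqrtr_sqr; apply: ler_wsqrtr.
rewrite fE gE in H.
apply/ler_addgt0Pr => e e0.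
have [xz|xz] := eqVneq x 0.
  have [yz|yz] := eqVneq y 0.
    by have := H 1 ltr01; rewrite xz yz; lra.
  have ep : 0 < e / y ^+ 2 by rewrite divr_gt0// exprn_gt0// lt_def yz.
  have := H (e / y ^+ 2)^-1; rewrite invr_gt0 => /(_ ep).
  rewrite xz invrK.
  have -> : (1 + e / y ^+ 2) * y ^+ 2 = y ^+ 2 + e by field.
  lra.
have xp : 0 < x by rewrite lt_def xz.
have [yz|yz] := eqVneq y 0.
  have ep : 0 < e / x ^+ 2 by rewrite divr_gt0// exprn_gt0.
  have := H _ ep; rewrite yz.
  have -> : (1 + e / x ^+ 2) * x ^+ 2 = x ^+ 2 + e by field.
  lra.
have yp : 0 < y by rewrite lt_def yz.
have := H (y / x); rewrite divr_gt0// => /(_ isT).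
have -> : (1 + y / x) * x ^+ 2 + (1 + (y / x)^-1) * y ^+ 2 = (x + y) ^+ 2.
  by field; rewrite xz yz.
lra.
Qed.

Lemma l2_normZ (c : R[i]) f : l2_norm (c *: f) = `|c| * l2_norm f.
Proof.
rewrite /l2_norm -[sumsq _]/(sumsq (c *: (f : X -> R[i]^o))) sumsqZ.
rewrite fineM ?l2_sumsq_fin// sqrtrM ?normsq_ge0//= rmorphM.
by case: c.
Qed.

Lemma l2_norm_eq0 f : l2_norm f = 0 -> f = 0.
Proof.
move=> /(congr1 (@complex.Re R)) /= /eqP; rewrite sqrtr_eq0 => fle.
apply/val_inj/funext => a; apply: normsq_eq0.
apply/eqP; rewrite eq_le normsq_ge0 andbT (le_trans _ fle)//.
by rewrite -lee_fin fineK ?l2_sumsq_fin// sumsq_term.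
Qed.

HB.instance Definition _ :=
  Lmodule_isNormed.Build R[i] l2 l2_normD l2_normZ l2_norm_eq0.

Lemma l2_normE f : `|f| = l2_norm f.
Proof. by []. Qed.

End square_summable.
Arguments square_summable {R X}.

Section spectrum.
Variables (K : numFieldType) (V : normedModType K).

(* The inverse of T - l is required to be linear and continuous (bounded), on
   the whole of V. *)
Definition resolvent_set (T : V -> V) : set K :=
  [set l | exists S : {linear V -> V},
    [/\ continuous S, cancel (fun v => T v - l *: v) S
      & cancel S (fun v => T v - l *: v)]].

Definition spectrum (T : V -> V) : set K := ~` resolvent_set T.

End spectrum.

Section adjoint.
Variables (R : realType) (X : choiceType).
Implicit Types T S : l2 R X -> l2 R X.

(* Unconditional sum of the family, i.e. the limit of its sums over the
   directed set of finite subsets; linear in u, conjugate-linear in v. *)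
Definition inner (u v : l2 R X) : R[i] :=
  summability.sum (fun a => (u a * conjc (v a) : R[i]^o)).

Definition is_adjoint T S := forall u v, inner (T u) v = inner u (S v).

(* [adjoint_unique] and [adjointE] make this the adjoint whenever there is one;
   the adjoints of the shifts exist by [adjoint_tau1] and [adjoint_tau2]. *)
Definition adjoint T : l2 R X -> l2 R X := get [set S | is_adjoint T S].

#[local] Existing Instance summability.totally_filter.

Lemma sum_reindex (s : X -> X) (x : X -> R[i]^o) : bijective s ->
  summability.sum (x \o s) = summability.sum x.
Proof.
case=> t st ts; rewrite /summability.sum; congr lim.
have sum_im (A : {fset X}) : summability.partial_sum (x \o s) A =
    summability.partial_sum x (s @` A)%fset.
  rewrite /summability.partial_sum -!(big_seq_fsetE _ _ predT) big_imfset//=.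
  by move=> a b _ _; exact: (can_inj st).
apply/seteqP; split=> B [A _ AB].
  exists (s @` A)%fset => // D /= AD.
  have -> : D = (s @` (t @` D))%fset.
    apply/fsetP => d; apply/idP/imfsetP => [dD|[c /imfsetP[d' d'D ->] ->]].
      by exists (t d); rewrite ?ts//; apply/imfsetP; exists d.
    by rewrite ts.
  rewrite -sum_im; apply: AB => /=; apply/fsubsetP => a aA.
  apply/imfsetP; exists (s a); rewrite ?st//.
  by apply: (fsubsetP AD); apply/imfsetP; exists a.
exists (t @` A)%fset => // D /= AD; rewrite sum_im; apply: AB => /=.
apply/fsubsetP => a aA; apply/imfsetP; exists (t a); rewrite ?ts//.
by apply: (fsubsetP AD); apply/imfsetP; exists a.
Qed.

Lemma eq_sum (x y : X -> R[i]^o) : x =1 y ->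
  summability.sum x = summability.sum y.
Proof. by move=> /funext ->. Qed.

Lemma sum_single (a : X) (x : X -> R[i]^o) : (forall b, b != a -> x b = 0) ->
  summability.sum x = x a.
Proof.
move=> x0; apply: cvg_lim; first exact: norm_hausdorff.
apply: cvg_near_cst; exists [fset a]%fset => // B /= aB.
rewrite /summability.partial_sum -(big_seq_fsetE _ _ predT) (big_fsetD1 a) /=; last first.
  by apply: (fsubsetP aB); rewrite inE.
rewrite big_seq big1 ?addr0// => b; rewrite !inE => /andP[/x0].
by [].
Qed.

Lemma delta_square_summable (a : X) :
  (fun b => (b == a)%:R : R[i]^o) \in square_summable.
Proof.
rewrite inE /= /sumsq (esumID [set a])//; last first.
  by move=> b _; rewrite lee_fin normsq_ge0.
rewrite setTI setTI esum_set1 ?lee_fin ?normsq_ge0// esum1 ?adde0 ?ltry//.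
by move=> b /= /eqP/negbTE ->; rewrite /normsq /= expr0n /= addr0.
Qed.

Lemma adjoint_unique T S S' : is_adjoint T S -> is_adjoint T S' -> S = S'.
Proof.
move=> TS TS'; apply/funext => v; apply/val_inj/funext => a /=.
have := TS (L2 (delta_square_summable a)) v; rewrite TS' /inner.
rewrite (sum_single (a := a)); last by move=> b /negbTE /= ->; rewrite mul0r.
rewrite (sum_single (a := a)); last by move=> b /negbTE /= ->; rewrite mul0r.
by rewrite /= eqxx !mul1r => /(can_inj (@conjcK R)) ->.
Qed.

Lemma adjointE T S : is_adjoint T S -> adjoint T = S.
Proof.
move=> TS; apply: (adjoint_unique (T := T)) => //.
exact: (@getI _ [set S | is_adjoint T S] S).
Qed.

End adjoint.

Section shifts.
Variable R : realType.

(* exp (i x) *)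
Definition expi (x : R) : R[i] := (cos x +i* sin x)%C.

Lemma expi0 : expi 0 = 1.
Proof. by rewrite /expi cos0 sin0. Qed.

Lemma conj_expi (x : R) : conjc (expi x) = expi (- x).
Proof. by rewrite /expi cosN sinN. Qed.

Lemma normsq_expi (x : R) : normsq (expi x) = 1.
Proof. by rewrite /normsq /= cos2Dsin2. Qed.

Lemma sumsq_weighted_shift (X : choiceType) (v : X -> R[i]^o) (s : X -> X)
    (c : X -> R[i]) : bijective s -> (forall a, normsq (c a) = 1) ->
  sumsq (fun a => c a * v (s a)) = sumsq v.
Proof.
move=> bs c1; rewrite /sumsq [RHS](reindex_esum [set: X] _ s); last first.
  by rewrite setTT_bijective.
by apply: eq_esum => a _; rewrite normsqM c1 mul1r.
Qed.

Definition Z2 := (int * int)%type.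

Definition shift1 (k : int) (a : Z2) : Z2 := (a.1 + k, a.2).
Definition shift2 (k : int) (a : Z2) : Z2 := (a.1, a.2 + k).

Lemma shift1_bij k : bijective (shift1 k).
Proof. by exists (shift1 (- k)) => -[a b]; rewrite /shift1/= ?addrK ?subrK. Qed.

Lemma shift2_bij k : bijective (shift2 k).
Proof. by exists (shift2 (- k)) => -[a b]; rewrite /shift2/= ?addrK ?subrK. Qed.

Lemma tau1_subproof (k : int) (v : l2 R Z2) :
  (fun a : Z2 => v (a.1 + k, a.2)) \in square_summable.
Proof.
rewrite inE /= (_ : (fun a => _) = fun a => 1 * v (shift1 k a)); last first.
  by apply/funext => a; rewrite mul1r.
rewrite sumsq_weighted_shift; [|exact: shift1_bij|].
  by have := l2_valP v; rewrite inE.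
by move=> _; rewrite -expi0 normsq_expi.
Qed.

Lemma tau2_subproof (g : R) (k : int) (v : l2 R Z2) :
  (fun a : Z2 => expi (g * a.1%:~R) * v (a.1, a.2 + k) : R[i]^o)
    \in square_summable.
Proof.
rewrite inE /= (_ : (fun a => _) =
   fun a => expi (g * a.1%:~R) * v (shift2 k a))//.
rewrite sumsq_weighted_shift; [|exact: shift2_bij|].
  by have := l2_valP v; rewrite inE.
by move=> a; rewrite normsq_expi.
Qed.

Definition tau1 (v : l2 R Z2) : l2 R Z2 := L2 (tau1_subproof (-1) v).

Definition tau2 (g : R) (v : l2 R Z2) : l2 R Z2 := L2 (tau2_subproof g (-1) v).

Lemma adjoint_tau1 v a : adjoint tau1 v a = v (a.1 + 1, a.2).
Proof.
rewrite (@adjointE _ _ tau1 (fun v => L2 (tau1_subproof 1 v)))// => u w.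
rewrite /inner -[LHS](sum_reindex _ (shift1_bij 1)).
by apply: eq_sum => -[m n] /=; rewrite addrK.
Qed.

Lemma adjoint_tau2 g v a :
  adjoint (tau2 g) v a = expi (- (g * a.1%:~R)) * v (a.1, a.2 + 1).
Proof.
rewrite -mulNr (@adjointE _ _ (tau2 g) (fun v => L2 (tau2_subproof (- g) 1 v)))//.
move=> u w; rewrite /inner -[LHS](sum_reindex _ (shift2_bij 1)).
apply: eq_sum => -[m n] /=.
rewrite addrK rmorphM -[X in _ = _ * (X * _)]/(conjc _) conj_expi mulNr opprK.
by rewrite mulrCA mulrA.
Qed.

End shifts.

Section operator_matrix.
Variables (R : realType) (n : nat) (X : choiceType).
(* A C^n-valued family (v_a) is encoded by its components, v (a, i) = (v_a)_i;
   square-summability and norm on X * 'I_n are those of l^2(X; C^n) for the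
   Euclidean norm of C^n ([sumsq_prod]). *)
Implicit Types (v : l2 R (X * 'I_n)%type) (w : 'I_n -> l2 R X).

Lemma sumsq_prod (x : X * 'I_n -> R[i]^o) :
  sumsq x = (\sum_(i < n) sumsq (fun a => x (a, i) : R[i]^o))%E.
Proof.
rewrite /sumsq -esum_sum; last by move=> *; rewrite lee_fin normsq_ge0.
transitivity (\esum_(a in [set: X]) \esum_(i in [set: 'I_n])
    (normsq (x (a, i)))%:E)%E.
  rewrite esum_esum; last by move=> *; rewrite lee_fin normsq_ge0.
  rewrite (_ : _ `*`` _ = setT); last by apply/seteqP; split.
  by apply: eq_esum => -[].
apply: eq_esum => a _; rewrite esum_fset//; last first.
  by move=> *; rewrite lee_fin normsq_ge0.
  exact: finite_finset.
rewrite (fsbigE (index_enum 'I_n))//= ?index_enum_uniq//; last first.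
  by move=> i _; rewrite mem_index_enum.
by apply: eq_bigl => i; rewrite in_setT.
Qed.

Lemma component_subproof v (i : 'I_n) :
  (fun a => v (a, i) : R[i]^o) \in square_summable.
Proof.
have := l2_valP v; rewrite !inE /= sumsq_prod; apply: le_lt_trans.
by rewrite (bigD1 i)//= leeDl// sume_ge0// => j _; exact: sumsq_ge0.
Qed.

Definition component v (i : 'I_n) : l2 R X := L2 (component_subproof v i).

Lemma of_components_subproof w :
  (fun ai => w ai.2 ai.1 : R[i]^o) \in square_summable.
Proof.
rewrite inE /= sumsq_prod; apply: lte_sum_pinfty => i _.
by have := l2_valP (w i); rewrite inE.
Qed.

Definition of_components w : l2 R (X * 'I_n)%type :=
  L2 (of_components_subproof w).

Definition op_of_mx (M : 'M[l2 R X -> l2 R X]_n) v : l2 R (X * 'I_n)%type :=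
  of_components (fun i => \sum_j M i j (component v j)).

End operator_matrix.

Section kagome.
Variable R : realType.
Implicit Types g w : R.

(* Indices of the matrix start at 0; products of operators are compositions. *)
Definition Qmx g w : 'M[l2 R Z2 -> l2 R Z2]_3 :=
  let t1 := @tau1 R in let t2 := tau2 g in
  let t1s := adjoint t1 in let t2s := adjoint t2 in
  let c := expi (w + g / 8) in let cb := expi (- (w + g / 8)) in
  let h := expi (- (g / 2)) in
  \matrix_(i, j) nth 0 (nth [::]
    [:: [:: 0;
            c *: (t1s + h *: (t1s \o t2));
            cb *: (t1s + t2s)];
        [:: cb *: (t1 + h *: (t1 \o t2s));
            0;
            c *: (h *: (t1 \o t2s) + t2s)];
        [:: c *: (t1 + t2);
            cb *: (h *: (t1s \o t2) + t2);
            0]] i) j.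

Definition Q g w : l2 R (Z2 * 'I_3)%type -> l2 R (Z2 * 'I_3)%type :=
  op_of_mx (Qmx g w).

Definition sigma g w : set R[i] := spectrum (Q g w).

End kagome.

(* Main.v *)
From HB Require Import structures.
Require Import Defs.
From mathcomp Require Import all_boot all_order all_algebra.
From mathcomp Require Import complex ring lra.
From mathcomp Require Import all_classical all_reals all_analysis.

Set Implicit Arguments.
Unset Strict Implicit.
Unset Printing Implicit Defensive.

Import Order.TTheory GRing.Theory Num.Theory.
Import numFieldNormedType.Exports.

Local Open Scope classical_set_scope.
Local Open Scope ring_scope.

(** Every entry of [Q] going from sublattice [i] to [i + 1] (mod 3) carries the
phase [e^{i(w + g/8)}], and there are two of them for each [i]. Hence
[Q = W_1 + W_1^* + W_2 + W_2^*], where each [W_b] is a unitary weighted shift with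
weights [e^{i(w + g/8 + g L_b(x)/2)}] for integers [L_b(x)]. So [Q] is symmetric
of norm at most 4, and a Neumann series gives [sigma] in [[-4, 4]].

Adding [16 pi] to [g] changes no weight and adding [8 pi] changes the sign of all
of them. Conjugating by [v_x |-> eps_x conj(v_x)] with signs [eps] replaces the
phases by their opposites up to the signs [eps_x eps_{hop x}]; this maps [sigma] to
its complex conjugate, that is to itself. Taking [eps = 1] gives the reflection at
[w = 0], and [eps_{m, n} = (-1)^{m + n}] the one at [w = pi/8]. *)

(** * The squared norm as a real number *)

Section energy.
Variables (R : realType) (X : choiceType).
Implicit Types (u v w : l2 R X) (c z : R[i]).

(** The norm of [l2] takes its values in [R[i]]; these real counterparts let the estimates take
    place in a totally ordered field. *)
Definition energy v : R := fine (sumsq v).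
Definition norm2 v : R := Num.sqrt (energy v).

Lemma energy_ge0 v : 0 <= energy v.
Proof. by rewrite fine_ge0// sumsq_ge0. Qed.

Lemma energyE v : (energy v)%:E = sumsq v.
Proof. by rewrite fineK// l2_sumsq_fin. Qed.

Lemma norm2_ge0 v : 0 <= norm2 v.
Proof. exact: sqrtr_ge0. Qed.

Lemma sqr_norm2 v : norm2 v ^+ 2 = energy v.
Proof. by rewrite sqr_sqrtr// energy_ge0. Qed.

Lemma norm2E v : `|v| = (norm2 v)%:C%C.
Proof. by []. Qed.

Lemma norm2D u v : norm2 (u + v) <= norm2 u + norm2 v.
Proof. by rewrite -lecR rmorphD -!norm2E ler_normD. Qed.

Lemma energyZ c v : energy (c *: v) = normsq c * energy v.
Proof. by rewrite /energy sumsqZ fineM// l2_sumsq_fin. Qed.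

Lemma norm2Z c v : norm2 (c *: v) = Num.sqrt (normsq c) * norm2 v.
Proof. by rewrite /norm2 energyZ sqrtrM// normsq_ge0. Qed.

Lemma normsqN z : normsq (- z) = normsq z.
Proof. by case: z => a b; rewrite /normsq /= !sqrrN. Qed.

Lemma energyN v : energy (- v) = energy v.
Proof. by rewrite -scaleN1r energyZ normsqN /normsq/=; lra. Qed.

Lemma norm2N v : norm2 (- v) = norm2 v.
Proof. by rewrite /norm2 energyN. Qed.

Lemma norm2_eq0 v : norm2 v = 0 -> v = 0.
Proof.
by move=> v0; apply: l2_norm_eq0; rewrite /l2_norm -/(energy v) -/(norm2 v) v0.
Qed.

Lemma norm2_0 : norm2 0 = 0.
Proof. by apply: complexI; rewrite -norm2E normr0. Qed.

Lemma norm2_coord v a : normsq (v a) <= norm2 v ^+ 2.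
Proof. by rewrite sqr_norm2 -lee_fin energyE sumsq_term. Qed.

Lemma energy_le v (M : R) :
  (forall s : seq X, uniq s -> \sum_(a <- s) normsq (v a) <= M) -> energy v <= M.
Proof.
move=> vM; rewrite -lee_fin energyE; apply: ge_ereal_sup => _ [A [finA _] <-].
by rewrite fsbig_finite//= sumEFin lee_fin vM.
Qed.

End energy.

Lemma l2_valD (R : realType) (X : choiceType) (u v : l2 R X) a :
  (u + v) a = u a + v a.
Proof. by []. Qed.

Lemma l2_valN (R : realType) (X : choiceType) (u : l2 R X) a : (- u) a = - u a.
Proof. by []. Qed.

Lemma l2_valZ (R : realType) (X : choiceType) (c : R[i]) (u : l2 R X) a :
  (c *: u) a = c * u a.
Proof. by []. Qed.

Lemma l2P (R : realType) (X : choiceType) (u v : l2 R X) : u =1 v -> u = v.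
Proof. by move=> uv; apply/val_inj/funext. Qed.

(** * Completeness of [l2] along sequences with geometrically decaying steps *)

Section completeness.
Variable R : realType.

(** Telescoping turns the sequence into a series dominated by a geometric one. *)
Lemma cvg_geometric_steps (x : nat -> R) (C q : R) : 0 <= q < 1 ->
  (forall n, `|x n.+1 - x n| <= C * q ^+ n) -> cvgn x.
Proof.
move=> /andP[q0 q1] xq.
have -> : x = fun n => x 0%N + series (telescope x) n.
  by apply/funext => n; exact: eq_sum_telescope.
apply: is_cvgD; first exact: is_cvg_cst.
apply: normed_cvg; apply: (@series_le_cvg _ _ (geometric C q)) => //.
- by move=> n; exact: normr_ge0.
- by move=> n; exact: le_trans (normr_ge0 _) (xq n).
- by apply: is_cvg_geometric_series; rewrite ger0_norm.
Qed.

Variable X : choiceType.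
Implicit Types (u v w : l2 R X) (c z : R[i]).

Lemma energy_ge_sum v (s : seq X) : uniq s ->
  \sum_(a <- s) normsq (v a) <= energy v.
Proof.
move=> us; rewrite -lee_fin energyE; apply: esum_ge; exists [set` s].
  by split => //; exact: finite_seq.
by rewrite -sumEFin -fsbig_seq.
Qed.

Lemma sqr_Re_le z : complex.Re z ^+ 2 <= normsq z.
Proof. by rewrite lerDl sqr_ge0. Qed.

Lemma sqr_Im_le z : complex.Im z ^+ 2 <= normsq z.
Proof. by rewrite lerDr sqr_ge0. Qed.

(** Real and imaginary parts converge at each coordinate. The bounds on finite partial sums pass to
    the limit, and the energy is the supremum of those sums. *)
Lemma l2_geometric_limit (u : nat -> l2 R X) (C q : R) : 0 <= q < 1 ->
  (forall n, norm2 (u n.+1 - u n) <= C * q ^+ n) ->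
  exists l, forall n, norm2 (l - u n) <= C / (1 - q) * q ^+ n.
Proof.
move=> q01 uq; have /andP[q0 q1] := q01; set K := C / (1 - q).
have q1' : 1 - q != 0 by rewrite subr_eq0 gt_eqF.
have C0 : 0 <= C.
  by have := uq 0%N; rewrite expr0 mulr1; apply: le_trans; exact: norm2_ge0.
have K0 : 0 <= K by rewrite divr_ge0// subr_ge0 ltW.
(* [K] solves [K * q + C = K], the recursion met when one more step is added in front. *)
have tail k n : norm2 (u (n + k)%N - u n) <= K * q ^+ n.
  elim: k n => [|k ih] n.
    by rewrite addn0 subrr norm2_0 mulr_ge0// exprn_ge0.
  rewrite addnS -addSn -(subrKA (u n.+1)) (le_trans (norm2D _ _))//.
  rewrite (le_trans (lerD (ih _) (uq n)))// exprS mulrA -mulrDl.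
  by rewrite (_ : K * q + C = K)// /K; field.
have cRe a : cvgn (fun n => complex.Re (u n a)).
  apply: (cvg_geometric_steps q01) => n; apply: le_trans _ (uq n).
  rewrite -ler_sqr ?nnegrE ?norm2_ge0// real_normK ?num_real//.
  apply: le_trans _ (norm2_coord (u n.+1 - u n) a); rewrite -raddfB.
  exact: sqr_Re_le.
have cIm a : cvgn (fun n => complex.Im (u n a)).
  apply: (cvg_geometric_steps q01) => n; apply: le_trans _ (uq n).
  rewrite -ler_sqr ?nnegrE ?norm2_ge0// real_normK ?num_real//.
  apply: le_trans _ (norm2_coord (u n.+1 - u n) a); rewrite -raddfB.
  exact: sqr_Im_le.
pose L a : R[i] := (limn (fun n => complex.Re (u n a)) +i*
                    limn (fun n => complex.Im (u n a)))%C.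
have Lu n (s : seq X) : uniq s ->
    \sum_(a <- s) normsq (L a - u n a) <= (K * q ^+ n) ^+ 2.
  move=> us.
  have : \sum_(a <- s) normsq (u m a - u n a) @[m --> \oo] -->
      \sum_(a <- s) normsq (L a - u n a).
    apply: cvg_big => [|a _]; first exact: add_continuous.
    have cR : complex.Re (u m a - u n a) @[m --> \oo] --> complex.Re (L a - u n a).
      by under eq_fun do rewrite raddfB; rewrite raddfB; apply: cvgB (cRe a) (cvg_cst _).
    have cI : complex.Im (u m a - u n a) @[m --> \oo] --> complex.Im (L a - u n a).
      by under eq_fun do rewrite raddfB; rewrite raddfB; apply: cvgB (cIm a) (cvg_cst _).
    by apply: cvgD; apply: cvgM.
  move=> /cvgr_to_le; apply; exists n => // m /= nm.
  apply: le_trans (energy_ge_sum (u m - u n) us) _.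
  rewrite -sqr_norm2 ler_sqr ?nnegrE ?norm2_ge0//; last first.
    by rewrite mulr_ge0// exprn_ge0.
  by rewrite -(subnKC nm) tail.
have LuP n : (fun a => L a - u n a : R[i]^o) \in square_summable.
  rewrite inE /=; apply: (@le_lt_trans _ _ ((K * q ^+ n) ^+ 2)%:E); last by rewrite ltry.
  apply: ge_ereal_sup => _ [A [finA _] <-].
  by rewrite fsbig_finite//= sumEFin lee_fin Lu.
(* Only the differences [L - u n] are known to be square-summable, so [L] enters as
   [(L - u 0) + u 0]. *)
exists (L2 (LuP 0%N) + u 0%N) => n.
rewrite -ler_sqr ?nnegrE ?norm2_ge0//; last by rewrite mulr_ge0// exprn_ge0.
rewrite sqr_norm2; apply: energy_le => s us; apply: le_trans _ (Lu n s us).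
by apply: ler_sum => a _; rewrite l2_valD l2_valN l2_valD /= subrK.
Qed.

End completeness.

(** * Neumann series and membership in the resolvent set *)

Section neumann.
Variables (R : realType) (X : choiceType).
Notation V := (l2 R X).
Implicit Types (u v w : V) (c z l : R[i]).

Lemma bounded_continuous (S : {linear V -> V}) (M : R) :
  (forall v, norm2 (S v) <= M * norm2 v) -> continuous S.
Proof.
move=> SM; apply/linear_bounded_continuous/linear_boundedP.
exists M%:C%C; split; first by rewrite complex_real.
move=> r Mr v; rewrite !norm2E (le_trans _ (ler_wpM2r _ (ltW Mr)))//.
  by rewrite -rmorphM lecR.
by rewrite lecR norm2_ge0.
Qed.

(** The lower bound makes [D] injective, so a chosen right inverse is linear and two-sided; it also
    bounds that inverse by [m^-1]. *)
Lemma inverse_of_bounded_below (D : {linear V -> V}) (m : R) : 0 < m ->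
    (forall w, exists u, D u = w) -> (forall u, m * norm2 u <= norm2 (D u)) ->
  exists S : {linear V -> V}, [/\ continuous S, cancel D S & cancel S D].
Proof.
move=> m0 /choice[S DS] mD.
have injD : injective D.
  move=> u v /eqP; rewrite -subr_eq0 -raddfB => /eqP Duv.
  apply/eqP; rewrite -subr_eq0; apply/eqP/norm2_eq0/eqP.
  rewrite eq_le norm2_ge0 andbT -(pmulr_rle0 _ m0) (le_trans (mD _))//.
  by rewrite Duv norm2_0.
have linS : linear S by move=> c u v; apply: injD; rewrite linearP !DS.
pose Sl : {linear V -> V} := HB.pack S (GRing.isLinear.Build _ _ _ _ S linS).
exists Sl; split => [|u|//]; last by apply: injD; rewrite /= DS.
apply: (@bounded_continuous _ m^-1) => v.
by rewrite ler_pdivlMl// (le_trans (mD _))//= DS.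
Qed.

(** The lower bound is the triangle inequality. For surjectivity, a solution of [K u - u = w] is a
    fixed point of the contraction [F u = K u - w], found by iterating [F] from 0. *)
Lemma neumann (K : {linear V -> V}) (q : R) : 0 <= q < 1 ->
  (forall v, norm2 (K v) <= q * norm2 v) ->
  (forall v, (1 - q) * norm2 v <= norm2 (K v - v)) /\
  (forall w, exists u, K u - u = w).
Proof.
move=> q01 Kq; have /andP[q0 q1] := q01; split=> [v|w].
  have := norm2D (v - K v) (K v); rewrite subrK.
  have -> : norm2 (v - K v) = norm2 (K v - v) by rewrite -norm2N opprB.
  by have := Kq v; lra.
pose F u := K u - w; pose x n := iter n F 0.
have FB u v : F u - F v = K (u - v).
  by rewrite /F [RHS]linearB opprB addrA subrK.
have [y yx] : exists y, forall n,
    norm2 (y - x n) <= norm2 (F 0) / (1 - q) * q ^+ n.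
  apply: l2_geometric_limit => //; elim=> [|n ih].
    by rewrite /x /= subr0 expr0 mulr1.
  rewrite [x n.+2]/(F (x n.+1)) [X in _ - X]/(F (x n)) FB (le_trans (Kq _))//.
  by rewrite exprS mulrCA ler_wpM2l.
exists y; apply/eqP; rewrite subr_eq addrC -subr_eq -subr_eq0; apply/eqP/norm2_eq0/eqP.
rewrite eq_le norm2_ge0 andbT -/(F y).
set C := norm2 (F 0) / (1 - q) in yx.
(* Both [F y - x n.+1 = K (y - x n)] and [x n.+1 - y] have norm at most [C * q ^+ n], so the norm of
   [F y - y] is below a sequence tending to 0. *)
have C2 : C * 2 * q ^+ n @[n --> \oo] --> C * 2 * 0.
  by apply: cvgMr; apply: cvg_expr; rewrite ger0_norm.
rewrite -[leRHS](mulr0 (C * 2)); apply: (cvgr_to_ge C2); near=> n.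
rewrite -(subrKA (x n.+1)) (le_trans (norm2D _ _))//.
have -> : norm2 (x n.+1 - y) = norm2 (y - x n.+1) by rewrite -norm2N opprB.
rewrite [X in F y - X]/(F (x n)) FB.
have h1 := Kq (y - x n); have h2 := yx n; have h3 := yx n.+1.
have C0 : 0 <= C * q ^+ n by exact: le_trans (norm2_ge0 _) h2.
rewrite exprS in h3.
have : q * norm2 (y - x n) <= C * q ^+ n.
  by rewrite (le_trans _ h2)// ler_piMl ?norm2_ge0// ltW.
have : C * (q * q ^+ n) <= C * q ^+ n by rewrite mulrCA ler_piMl// ltW.
lra.
Unshelve. all: by end_near. Qed.

(* Neumann series for [T - l = (T - c) - (l - c)]. *)
Lemma resolvent_far_norm (T : {linear V -> V}) c l (q : R) : 0 <= q < 1 -> l != c ->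
    (forall v, norm2 (T v - c *: v) <= q * Num.sqrt (normsq (l - c)) * norm2 v) ->
  resolvent_set T l.
Proof.
move=> q01 lc Tc.
pose d := l - c; have d0 : d != 0 by rewrite subr_eq0.
have d0' : 0 < Num.sqrt (normsq d).
  rewrite sqrtr_gt0 lt_def normsq_ge0 andbT; apply: contra_neq d0.
  exact: normsq_eq0.
have linK : linear (fun v => d^-1 *: (T v - c *: v)).
  move=> a u v; rewrite /= linearP [_ *: (a *: u + v)]scalerDr opprD addrACA.
  rewrite scalerDr !scalerA.
  by rewrite (mulrC c) -[(a * c) *: u]scalerA -scalerBr scalerA (mulrC _ a).
pose K : {linear V -> V} := HB.pack (fun v => d^-1 *: (T v - c *: v))
  (GRing.isLinear.Build _ _ _ _ _ linK).
have KE v : K v = d^-1 *: (T v - c *: v) by [].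
have Kq v : norm2 (K v) <= q * norm2 v.
  rewrite KE -(ler_pM2l d0') -norm2Z scalerA divff// scale1r.
  by rewrite (le_trans (Tc v))// mulrCA mulrA.
have [Klow Ksurj] := neumann q01 Kq.
have linD : linear (fun v => T v - l *: v).
  move=> a u v; rewrite /= linearP [_ *: (a *: u + v)]scalerDr opprD addrACA scalerA.
  by rewrite (mulrC l) -scalerA -scalerBr.
pose D : {linear V -> V} := HB.pack (fun v => T v - l *: v)
  (GRing.isLinear.Build _ _ _ _ _ linD).
have DE v : D v = d *: (K v - v).
  rewrite KE scalerBr scalerA divff// scale1r /d scalerBl opprB addrA.
  by rewrite subrK.
have := @inverse_of_bounded_below D (Num.sqrt (normsq d) * (1 - q)).
rewrite mulr_gt0 ?subr_gt0//; last by case/andP: q01.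
move=> /(_ isT)[w|u|S [cS DS SD]].
- have [u ku] := Ksurj (d^-1 *: w); exists u.
  by rewrite DE ku scalerA divff// scale1r.
- by rewrite DE norm2Z -mulrA ler_wpM2l ?Klow// sqrtr_ge0.
by exists S.
Qed.
End neumann.

(** * Bounded symmetric operators have real, bounded spectrum *)

Section symmetric.
Variables (R : realType) (X : choiceType).
Notation V := (l2 R X).
Implicit Types (u v w : V) (c z l : R[i]).

(** Squared form of [resolvent_far_norm], since [symmetric_op] controls energies; the ratio of norms
    becomes [q = Num.sqrt (B / normsq (l - c))]. *)
Lemma resolvent_far (T : {linear V -> V}) c l (B : R) : 0 <= B < normsq (l - c) ->
    (forall v, energy (T v - c *: v) <= B * energy v) ->
  resolvent_set T l.
Proof.
move=> /andP[B0 Blc] TB.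
have n0 : 0 < normsq (l - c) by exact: le_lt_trans Blc.
apply: (@resolvent_far_norm _ _ T c l (Num.sqrt (B / normsq (l - c)))).
- rewrite sqrtr_ge0/= -[ltRHS]sqrtr1 ltr_sqrt ?ltr01//.
  by rewrite ltr_pdivrMr// mul1r.
- apply: contraTneq n0 => ->; rewrite subrr /normsq/= expr0n/= addr0 ltxx//.
move=> v; rewrite -sqrtrM ?divr_ge0 ?normsq_ge0// divfK ?gt_eqF//.
by rewrite -sqrtrM// ler_wsqrtr.
Qed.

(** Quadratic identities are checked coordinate by coordinate. Keeping both sides as sums of
    nonnegative terms lets the sums be exchanged in the extended reals. *)
Lemma energy_identity (s t : seq V) :
  (forall a, \sum_(u <- s) normsq (u a) = \sum_(u <- t) normsq (u a)) ->
  \sum_(u <- s) energy u = \sum_(u <- t) energy u.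
Proof.
move=> st; apply: EFin_inj.
have sumE r : (\sum_(u <- r) energy u)%:E =
    (\esum_(a in [set: X]) (\sum_(u <- r) normsq ((u : V) a))%:E)%E.
  under eq_esum => a _ do rewrite -sumEFin.
  rewrite esum_sum; last by move=> *; rewrite lee_fin normsq_ge0.
  by rewrite -sumEFin; apply: eq_bigr => u _; rewrite energyE.
by rewrite !sumE; apply: eq_esum => a _; rewrite st.
Qed.

(** After polarisation this is the additivity of [Re <u, w>] in [u]. *)
Lemma energyD3 u v w : energy (u + v + w) + energy u + energy v + energy w =
  energy (u + v) + energy (v + w) + energy (u + w).
Proof.
have : \sum_(x <- [:: u + v + w; u; v; w]) energy x =
    \sum_(x <- [:: u + v; v + w; u + w]) energy x.
  apply: energy_identity => a; rewrite !big_cons !big_nil !l2_valD.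
  by case: (u a) (v a) (w a) => [? ?] [? ?] [? ?]; rewrite /normsq /=; ring.
rewrite !big_cons !big_nil.
move: (energy u) (energy v) (energy w) (energy (u + v)) (energy (v + w)).
move: (energy (u + w)) (energy (u + v + w)) => *; lra.
Qed.

(** The cross terms [2 Re <u, i t v>] and [2 Re <i t u, v>] are opposite. *)
Lemma energy_swap_imaginary (t : R) u v :
  energy (u + (t *i)%C *: v) + energy ((t *i)%C *: u + v) =
  (1 + t ^+ 2) * (energy u + energy v).
Proof.
have := @energy_identity [:: u + (t *i)%C *: v; (t *i)%C *: u + v]
  [:: u; v; (t *i)%C *: u; (t *i)%C *: v].
rewrite !big_cons !big_nil !addr0 => ->; last first.
  move=> a; rewrite !big_cons !big_nil !l2_valD !l2_valZ.
  by case: (u a) (v a) => [? ?] [? ?]; rewrite /normsq /=; ring.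
by rewrite !energyZ /normsq/=; ring.
Qed.

(* For linear [T] this says that [<T v, v>] is real, without any inner product. *)
Definition symmetric_op (T : V -> V) := forall v (t : R),
  energy (T v + (t *i)%C *: v) = energy (T v) + t ^+ 2 * energy v.

Lemma symmetric_opDr (T S : V -> V) : symmetric_op T -> symmetric_op S ->
  symmetric_op (fun v => T v + S v).
Proof.
move=> Tsym Ssym v t; have := energyD3 (T v) (S v) ((t *i)%C *: v).
rewrite Tsym Ssym energyZ /normsq/=; lra.
Qed.

Lemma symmetric_scale (x : R) : symmetric_op (fun v => x%:C%C *: v).
Proof. by move=> v t; rewrite -scalerDl !energyZ /normsq/=; ring. Qed.

(** This is the symmetry of [U + U^*] for unitary [U]. The isometry turns [U v + i t v] into
    [v + i t U' v], whose energy pairs with that of [U' v + i t v] in [energy_swap_imaginary]. *)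
Lemma symmetric_isometryD_inverse (U : {linear V -> V}) (U' : V -> V) :
    (forall v, energy (U v) = energy v) -> (forall v, energy (U' v) = energy v) ->
    cancel U' U ->
  symmetric_op (fun v => U v + U' v).
Proof.
move=> Ue U'e UU' v t; have := energyD3 (U v) (U' v) ((t *i)%C *: v).
have -> : energy (U v + (t *i)%C *: v) = energy (v + (t *i)%C *: U' v).
  by rewrite -{2}[v]UU' -linearZ -linearD Ue.
have := energy_swap_imaginary t v (U' v).
rewrite (addrC (_ *: v)) !energyZ Ue U'e /normsq/=.
move: (energy v) (energy (v + (t *i)%C *: U' v)) (energy (U v + U' v)).
move: (energy (U' v + (t *i)%C *: v)) (energy (U v + U' v + (t *i)%C *: v)) => *; lra.
Qed.

Lemma spectrum_symmetric (T : {linear V -> V}) (M : R) : 0 <= M ->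
    (forall v, norm2 (T v) <= M * norm2 v) -> symmetric_op T ->
  spectrum T `<=` [set x%:C%C | x in `[- M, M]%classic].
Proof.
move=> M0 TM Tsym l; apply: contra_notP => lM.
have eTM v (x : R) : energy (T v - x%:C%C *: v) <= (M + `|x|) ^+ 2 * energy v.
  rewrite -!sqr_norm2 -exprMn ler_sqr ?nnegrE ?norm2_ge0//; last first.
    by rewrite mulr_ge0 ?norm2_ge0// addr_ge0.
  rewrite (le_trans (norm2D _ _))// norm2N norm2Z /normsq/= expr0n/= addr0.
  by rewrite sqrtr_sqr mulrDl lerD2r.
case: l lM => x y lM; have [y0|y0] := eqVneq y 0.
  (* For real [l] the centre 0 suffices: lying outside the interval means [M < |x|]. *)
  subst y; apply: (@resolvent_far _ 0 _ (M ^+ 2)); last first.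
    by move=> v; have := eTM v 0; rewrite normr0 addr0.
  rewrite sqr_ge0 subr0 /normsq/= expr0n/= addr0 -[x ^+ 2]real_normK ?num_real//.
  rewrite ltr_sqr ?nnegrE// ltNge; apply/negP => xM; apply: lM.
  by exists x => //=; rewrite in_itv/= -ler_norml.
(* With [B = T - x - i (y - s)], one has [|B|^2 <= A + (y - s)^2], which is less than
   [s^2] for [s = y k] with [k] large; hence [T - (x + i y) = B - i s] is invertible. *)
pose A := (M + `|x|) ^+ 2; have A0 : 0 <= A by exact: sqr_ge0.
have y2 : 0 < y ^+ 2 by rewrite lt_def sqrf_eq0 y0 sqr_ge0.
(* With this [k], the gap [s^2 - A - (y - s)^2 = 2 y^2 k - A - y^2] equals [A + y^2 > 0]. *)
pose k := (A + y ^+ 2) / y ^+ 2.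
have yk : y ^+ 2 * k = A + y ^+ 2 by rewrite mulrC divfK ?gt_eqF.
apply: (@resolvent_far _ (x +i* (y - y * k))%C _ (A + (y - y * k) ^+ 2)).
  rewrite addr_ge0 ?sqr_ge0//= /normsq/= subrr expr0n/= add0r.
  rewrite -subr_gt0; have -> : (y - (y - y * k)) ^+ 2 - (A + (y - y * k) ^+ 2) =
    2 * (y ^+ 2 * k) - A - y ^+ 2 by ring.
  by rewrite yk; lra.
move=> v.
have -> : T v - (x +i* (y - y * k))%C *: v =
    (T v + (- x)%:C%C *: v) + ((- (y - y * k)) *i)%C *: v.
  rewrite -addrA -scalerDl -scaleNr; congr (_ + _ *: _).
  by apply/eqP; rewrite eq_complex /= addr0 add0r !eqxx.
rewrite (symmetric_opDr Tsym (symmetric_scale (- x))) sqrrN mulrDl lerD2r.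
by rewrite rmorphN scaleNr eTM.
Qed.

End symmetric.

(** * Negation and antiunitary maps acting on spectra *)

Section conjc_morphism.
Variable R : realType.
Implicit Types y z : R[i].

Lemma conjcM y z : conjc (y * z) = conjc y * conjc z.
Proof. exact: rmorphM. Qed.

Lemma conjcD y z : conjc (y + z) = conjc y + conjc z.
Proof. exact: rmorphD. Qed.

Lemma conjcN z : conjc (- z) = - conjc z.
Proof. exact: rmorphN. Qed.

End conjc_morphism.

Section transport.
Variables (R : realType) (X : choiceType).
Notation V := (l2 R X).
Implicit Types (u v w : V) (c z l : R[i]).

Lemma resolventN (T : V -> V) l : {morph T : v / - v} ->
  resolvent_set T (- l) -> resolvent_set (fun v => - T v) l.
Proof.
move=> TN [S [cS TS ST]].
have linS : linear (fun v => - S v).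
  by move=> c u v; rewrite linearP opprD scalerN.
pose S' : {linear V -> V} := HB.pack (fun v => - S v)
  (GRing.isLinear.Build _ _ _ _ _ linS).
exists S'; split=> [v|v|v] /=; first exact: cvgN (cS v).
- by rewrite -opprD linearN opprK -[RHS]TS scaleNr opprK.
- by rewrite -[RHS]ST TN scalerN !opprK scaleNr opprK.
Qed.

Lemma spectrumN (T : V -> V) l : {morph T : v / - v} ->
  spectrum (fun v => - T v) l <-> spectrum T (- l).
Proof.
move=> TN; split; apply: contra_not; first exact: resolventN.
move=> Tl.
have -> : T = fun v => - - T v by apply/funext => v; rewrite opprK.
by apply: resolventN => [v|]; rewrite ?TN ?opprK.
Qed.

(** The inverse is [theta S theta]: two antilinear maps around a linear one give a linear one, with
    the same bound as [S]. Moving the scalar [l] through [theta] conjugates it. *)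
Lemma resolvent_antiunitary (theta : V -> V) (T T' : V -> V) l :
    {morph theta : u v / u + v} ->
    (forall c v, theta (c *: v) = conjc c *: theta v) ->
    (forall v, energy (theta v) = energy v) -> involutive theta ->
    (forall v, T' (theta v) = theta (T v)) ->
  resolvent_set T l -> resolvent_set T' (conjc l).
Proof.
move=> tD tZ te tK TT' [S [cS TS ST]].
have linS : linear (fun v => theta (S (theta v))).
  by move=> c u v; rewrite tD tZ linearP tD tZ conjcK.
pose S' : {linear V -> V} := HB.pack (fun v => theta (S (theta v)))
  (GRing.isLinear.Build _ _ _ _ _ linS).
have tB u v : theta (u - v) = theta u - theta v.
  by rewrite -scaleN1r tD tZ rmorphN rmorph1 scaleN1r.
have T'E v : T' v = theta (T (theta v)) by rewrite -TT' tK.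
have tn v : norm2 (theta v) = norm2 v by rewrite /norm2 te.
exists S'; split=> [|v|v].
- apply/linear_bounded_continuous/linear_boundedP.
  move/linear_bounded_continuous/linear_boundedP : cS.
  apply: filterS => r Sr v.
  by have := Sr (theta v); rewrite !norm2E/= !tn.
- by rewrite /S'/= T'E tB tK tZ conjcK TS tK.
- by rewrite /S'/= TT' -tZ -tB ST tK.
Qed.

Lemma spectrum_antiunitary (theta : V -> V) (T T' : V -> V) l :
    {morph theta : u v / u + v} ->
    (forall c v, theta (c *: v) = conjc c *: theta v) ->
    (forall v, energy (theta v) = energy v) -> involutive theta ->
    (forall v, T' (theta v) = theta (T v)) ->
  spectrum T' (conjc l) <-> spectrum T l.
Proof.
move=> tD tZ te tK TT'; split; apply: contra_not.
  exact: resolvent_antiunitary TT'.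
rewrite -{2}[l]conjcK; apply: (@resolvent_antiunitary theta) => // v.
by rewrite -[in RHS](tK v) TT' tK.
Qed.

Section twisted_conjugation.
Variable eps : X -> R.
Hypothesis eps2 : forall x, eps x ^+ 2 = 1.

Lemma normsq_twisted_conj x z : normsq ((eps x)%:C%C * conjc z) = normsq z.
Proof.
by case: z => a b; rewrite normsqM /normsq/= sqrrN expr0n/= addr0 eps2 mul1r.
Qed.

Lemma twisted_conj_subproof v :
  (fun x => (eps x)%:C%C * conjc (v x) : R[i]^o) \in square_summable.
Proof.
have := l2_valP v; rewrite !inE /= /sumsq.
by under [in X in _ -> X]eq_esum do rewrite normsq_twisted_conj.
Qed.

Definition twisted_conj v : V := L2 (twisted_conj_subproof v).

Lemma twisted_conjE v x : twisted_conj v x = (eps x)%:C%C * conjc (v x).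
Proof. by []. Qed.

Lemma twisted_conjD : {morph twisted_conj : u v / u + v}.
Proof.
by move=> u v; apply: l2P => x; rewrite !(l2_valD, twisted_conjE) conjcD mulrDr.
Qed.

Lemma twisted_conjZ c v : twisted_conj (c *: v) = conjc c *: twisted_conj v.
Proof.
by apply: l2P => x; rewrite !(l2_valZ, twisted_conjE) conjcM mulrCA.
Qed.

Lemma energy_twisted_conj v : energy (twisted_conj v) = energy v.
Proof. by congr fine; apply: eq_esum => x _; rewrite normsq_twisted_conj. Qed.

Lemma twisted_conjK : involutive twisted_conj.
Proof.
move=> v; apply: l2P => x.
by rewrite !twisted_conjE conjcM conjcK conjc_real mulrA -rmorphM -expr2 eps2 mul1r.
Qed.

End twisted_conjugation.
End transport.

(** * Phases and integer multiples of [pi] *)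

Section phases.
Variable R : realType.
Implicit Types x y : R.

Lemma expiD x y : expi (x + y) = expi x * expi y.
Proof. by rewrite /expi cosD sinD; apply/eqP; rewrite eq_complex /= eqxx addrC eqxx. Qed.

Lemma expi_pi_int (k : int) : expi (pi * k%:~R : R) = ((-1) ^ k)%:C%C.
Proof.
have nat_case n : expi (pi * n%:R : R) = ((-1) ^+ n)%:C%C.
  elim: n => [|n ih]; first by rewrite mulr0 expi0 expr0.
  rewrite -natr1 mulrDr mulr1 expiD ih exprSr rmorphM/=.
  by rewrite [expi pi]/expi cospi sinpi.
case: k => n; first by rewrite -pmulrn nat_case.
rewrite NegzE mulrNz mulrN -conj_expi (nat_case n.+1) conjc_real.
by rewrite -exprnN -exprVn invrN1.
Qed.


End phases.

(** * Hopping operators: sums of two weighted shifts and their inverses *)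

Section hopping.
Variables (R : realType) (X : choiceType) (s t : bool -> X -> X).
Hypotheses (sK : forall b, cancel (s b) (t b)) (tK : forall b, cancel (t b) (s b)).
Notation V := (l2 R X).
Implicit Types (u v : V) (theta : bool -> X -> R).

Lemma weighted_shift_subproof (f : X -> X) (p : X -> R) v : bijective f ->
  (fun x => expi (p x) * v (f x) : R[i]^o) \in square_summable.
Proof.
move=> bf; rewrite inE /= sumsq_weighted_shift//; last by move=> x; exact: normsq_expi.
by have := l2_valP v; rewrite inE.
Qed.

Definition forward theta b v : V :=
  L2 (weighted_shift_subproof (theta b) v (Bijective (sK b) (tK b))).

(** The inverse, hence the adjoint, of [forward theta b]: the opposite phase is read at [t b x], the
    site whose forward hop leads to [x]. *)
Definition backward theta b v : V :=
  L2 (weighted_shift_subproof (fun x => - theta b (t b x)) v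
        (Bijective (tK b) (sK b))).

Lemma forwardE theta b v x : forward theta b v x = expi (theta b x) * v (s b x).
Proof. by []. Qed.

Lemma backwardE theta b v x :
  backward theta b v x = expi (- theta b (t b x)) * v (t b x).
Proof. by []. Qed.

Definition hopping theta v : V :=
  \sum_(b : bool) (forward theta b v + backward theta b v).

Lemma hoppingE theta v : hopping theta v =
  (forward theta true v + backward theta true v) +
  (forward theta false v + backward theta false v).
Proof. by rewrite /hopping big_bool. Qed.

Lemma forward_linear theta b : linear (forward theta b).
Proof.
move=> c u v; apply: l2P => x.
by rewrite !(forwardE, backwardE, l2_valD, l2_valZ) mulrDr mulrCA.
Qed.

HB.instance Definition _ theta b :=
  GRing.isLinear.Build _ _ _ _ (forward theta b) (forward_linear theta b).

Lemma backward_linear theta b : linear (backward theta b).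
Proof.
move=> c u v; apply: l2P => x.
by rewrite !(forwardE, backwardE, l2_valD, l2_valZ) mulrDr mulrCA.
Qed.

Lemma hopping_linear theta : linear (hopping theta).
Proof.
move=> c u v; rewrite !hoppingE !forward_linear !backward_linear !scalerDr.
by rewrite (addrACA (c *: forward theta true u))
  (addrACA (c *: forward theta false u)) [LHS]addrACA.
Qed.

HB.instance Definition _ theta :=
  GRing.isLinear.Build _ _ _ _ (hopping theta) (hopping_linear theta).

Lemma energy_forward theta b v : energy (forward theta b v) = energy v.
Proof.
by congr fine; apply: sumsq_weighted_shift => [|x]; [exists (t b)|exact: normsq_expi].
Qed.

Lemma energy_backward theta b v : energy (backward theta b v) = energy v.
Proof.
by congr fine; apply: sumsq_weighted_shift => [|x]; [exists (s b)|exact: normsq_expi].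
Qed.

Lemma backwardK theta b : cancel (backward theta b) (forward theta b).
Proof.
move=> v; apply: l2P => x; rewrite forwardE backwardE.
by rewrite mulrA -expiD sK subrr expi0 mul1r.
Qed.

Lemma spectrum_hopping theta :
  spectrum (hopping theta) `<=` [set x%:C%C | x in `[-4, 4]%classic].
Proof.
apply: spectrum_symmetric => // [v|].
  rewrite /= hoppingE (le_trans (norm2D _ _))//.
  have n f : energy (f v) = energy v -> norm2 (f v) = norm2 v by rewrite /norm2 => ->.
  have := norm2D (forward theta true v) (backward theta true v).
  have := norm2D (forward theta false v) (backward theta false v).
  rewrite !n ?energy_forward ?energy_backward//; lra.
have sym b : symmetric_op (fun v => forward theta b v + backward theta b v).
  apply: (@symmetric_isometryD_inverse _ _ (forward theta b) (backward theta b)) => v.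
  - exact: energy_forward.
  - exact: energy_backward.
  - exact: backwardK.
move=> v r; rewrite /= hoppingE; exact: (symmetric_opDr (sym true) (sym false)).
Qed.

(** Backward weights are conjugates of forward ones, so a condition on the forward weights
    suffices. *)
Lemma eq_hopping theta theta' :
  (forall b x, expi (theta' b x) = expi (theta b x)) ->
  hopping theta' = hopping theta.
Proof.
move=> tt; apply/funext => v; rewrite !hoppingE; apply: l2P => x.
by rewrite !(forwardE, backwardE, l2_valD) -!conj_expi !tt.
Qed.

Lemma hoppingN theta theta' :
  (forall b x, expi (theta' b x) = - expi (theta b x)) ->
  hopping theta' = fun v => - hopping theta v.
Proof.
move=> tt; apply/funext => v; rewrite !hoppingE; apply: l2P => x.
by rewrite !(forwardE, backwardE, l2_valN, l2_valD) -!conj_expi !tt !conjcN; ring.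
Qed.

(** Conjugation reverses the phases, and moving the signs across a hop leaves the product of the
    signs at its two ends. That product is the same in both directions, so the backward terms follow
    from the hypothesis at [t b x]. *)
Lemma hopping_twisted_conj (eps : X -> R) (eps2 : forall x, eps x ^+ 2 = 1)
    theta theta' v :
  (forall b x, expi (theta' b x) =
     (eps x * eps (s b x))%:C%C * expi (- theta b x)) ->
  hopping theta' (twisted_conj eps2 v) = twisted_conj eps2 (hopping theta v).
Proof.
move=> tt; rewrite !hoppingE; apply: l2P => x.
have e2 y : (eps y)%:C%C * (eps y)%:C%C = 1 :> R[i] by rewrite -rmorphM -expr2 eps2.
have fw b : expi (theta' b x) * ((eps (s b x))%:C%C * conjc (v (s b x))) =
    (eps x)%:C%C * conjc (expi (theta b x) * v (s b x)).
  rewrite tt conjcM conj_expi rmorphM /=.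
  transitivity ((eps x)%:C%C * (expi (- theta b x) * conjc (v (s b x))) *
    ((eps (s b x))%:C%C * (eps (s b x))%:C%C)); first by ring.
  by rewrite e2 mulr1.
have bw b : expi (- theta' b (t b x)) * ((eps (t b x))%:C%C * conjc (v (t b x))) =
    (eps x)%:C%C * conjc (expi (- theta b (t b x)) * v (t b x)).
  rewrite -conj_expi tt tK !conjcM conjc_real !conj_expi opprK rmorphM /=.
  transitivity ((eps x)%:C%C * (expi (theta b (t b x)) * conjc (v (t b x))) *
    ((eps (t b x))%:C%C * (eps (t b x))%:C%C)); first by ring.
  by rewrite e2 mulr1.
rewrite twisted_conjE !(forwardE, backwardE, l2_valD) !twisted_conjE.
by rewrite !fw !bw !conjcD !mulrDr.
Qed.

Lemma spectrum_hopping_conj (eps : X -> R) theta theta' :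
    (forall x, eps x ^+ 2 = 1) ->
    (forall b x, expi (theta' b x) =
       (eps x * eps (s b x))%:C%C * expi (- theta b x)) ->
  spectrum (hopping theta') = spectrum (hopping theta).
Proof.
move=> eps2 tt.
have conjE l : spectrum (hopping theta') (conjc l) <-> spectrum (hopping theta) l.
  apply: (@spectrum_antiunitary _ _ (twisted_conj eps2)) => [|c v|v|v|v].
  - exact: twisted_conjD.
  - exact: twisted_conjZ.
  - exact: energy_twisted_conj.
  - exact: twisted_conjK.
  - exact: hopping_twisted_conj.
(* Both spectra are real by [spectrum_hopping], so the conjugation in [conjE] fixes their points. *)
apply/seteqP; split=> l /[dup] /spectrum_hopping[x _ <-].
  by rewrite -{1}conjc_real => /conjE.
by rewrite -{2}conjc_real => /conjE.
Qed.

End hopping.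

(** * The kagome operator as a hopping operator, and the symmetries of its phases *)

Section kagome_hopping.
Variable R : realType.
Notation V := (l2 R (Z2 * 'I_3)%type).
Implicit Types g w : R.

Definition ord3_0 : 'I_3 := @Ordinal 3 0 isT.
Definition ord3_1 : 'I_3 := @Ordinal 3 1 isT.
Definition ord3_2 : 'I_3 := @Ordinal 3 2 isT.

(* One of the two families of hops from sublattice [i] to [i + 1] (mod 3); the
   coefficient of the hop is [expi (kagome_phase g w b x)], where the twist collects
   the powers of [e^{i g / 2}] produced by [tau2] and the factors [e^{- i g / 2}]. *)
Definition kagome_step (b : bool) (x : Z2 * 'I_3) : Z2 * 'I_3 :=
  let: ((m, n), i) := x in
  match b, nat_of_ord i with
  | true, 0%N => ((m + 1, n), ord3_1)
  | true, 1%N => ((m - 1, n + 1), ord3_2)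
  | true, _ => ((m - 1, n), ord3_0)
  | false, 0%N => ((m + 1, n - 1), ord3_1)
  | false, 1%N => ((m, n + 1), ord3_2)
  | false, _ => ((m, n - 1), ord3_0)
  end.

Definition kagome_back (b : bool) (x : Z2 * 'I_3) : Z2 * 'I_3 :=
  let: ((m, n), i) := x in
  match b, nat_of_ord i with
  | true, 0%N => ((m + 1, n), ord3_2)
  | true, 1%N => ((m - 1, n), ord3_0)
  | true, _ => ((m + 1, n - 1), ord3_1)
  | false, 0%N => ((m, n + 1), ord3_2)
  | false, 1%N => ((m - 1, n + 1), ord3_0)
  | false, _ => ((m, n - 1), ord3_1)
  end.

(** The unit is [g / 2]. The odd values arise where the shift of the first coordinate changes the
    phase of [tau2] or its adjoint by [g], of which the factor [e^{- i g / 2}] leaves [g / 2]. *)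
Definition kagome_twist (b : bool) (x : Z2 * 'I_3) : int :=
  match b, nat_of_ord x.2 with
  | true, 1%N => 1 - 2 * x.1.1
  | true, _ => 0
  | false, 0%N => 2 * x.1.1 + 1
  | false, 1%N => - 2 * x.1.1
  | false, _ => 2 * x.1.1
  end.

Definition kagome_phase g w (b : bool) (x : Z2 * 'I_3) : R :=
  w + g / 8 + g * (kagome_twist b x)%:~R / 2.

Lemma ord3P (P : 'I_3 -> Prop) : P ord3_0 -> P ord3_1 -> P ord3_2 -> forall i, P i.
Proof.
by move=> P0 P1 P2 [[|[|[|//]]] i3];
  [move: P0|move: P1|move: P2]; congr P; apply: val_inj.
Qed.

Lemma kagome_stepK b : cancel (kagome_step b) (kagome_back b).
Proof.
case=> -[m n]; elim/ord3P; case: b => //=; by rewrite ?addrK ?subrK.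
Qed.

Lemma kagome_backK b : cancel (kagome_back b) (kagome_step b).
Proof.
case=> -[m n]; elim/ord3P; case: b => //=; by rewrite ?addrK ?subrK.
Qed.

(** Entries [(i, i + 1)] modulo 3 are the forward hops and entries [(i, i - 1)] the backward ones;
    matching the latter with opposite phases at [kagome_back] is where the hermitian form of the
    matrix is verified. *)
Lemma Q_hopping g w :
  Q g w = hopping kagome_stepK kagome_backK (kagome_phase g w).
Proof.
apply/funext => v; apply: l2P => -[[m n]]; rewrite hoppingE.
have sumE (f : 'I_3 -> l2 R Z2) : \sum_j f j = f ord3_0 + (f ord3_1 + f ord3_2).
  rewrite !big_ord_recl big_ord0 addr0.
  by congr (f _ + (f _ + f _)); apply: val_inj.
have QE i : Q g w v ((m, n), i) = (\sum_j Qmx g w i j (component v j)) (m, n) by [].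
have cE i a : component v i a = v (a, i) by [].
have t1E (u : l2 R Z2) a : tau1 u a = u (a.1 - 1, a.2) by [].
have t2E (u : l2 R Z2) a : tau2 g u a = expi (g * a.1%:~R) * u (a.1, a.2 - 1) by [].
have zE (u : l2 R Z2) a : (0 : l2 R Z2 -> l2 R Z2) u a = 0 by [].
elim/ord3P; rewrite QE sumE !(l2_valD, l2_valZ) !mxE !fctE;
  cbn [nth nat_of_ord ord3_0 ord3_1 ord3_2];
  rewrite !(l2_valD, l2_valZ, adjoint_tau1, adjoint_tau2, t1E, t2E, zE, cE);
  rewrite !(forwardE, backwardE);
  cbn [fst snd kagome_step kagome_back nat_of_ord ord3_0 ord3_1 ord3_2];
  rewrite !mulrDr !mulrA -!expiD ?(add0r, addr0).
(* Only in the middle row does the backward entry precede the forward one. *)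
2: rewrite addrC.
all: rewrite addrACA; congr (expi _ * _ + expi _ * _ + (expi _ * _ + expi _ * _)).
all: rewrite /kagome_phase; cbn [fst snd kagome_twist nat_of_ord ord3_0 ord3_1 ord3_2].
all: rewrite ?(intrD, intrM, mulrNz); by field.
Qed.

Definition checkerboard (x : Z2 * 'I_3) : R := (-1) ^ (x.1.1 + x.1.2).

Lemma signz2 (k j : int) : (-1) ^ (k + 2 * j) = (-1) ^ k :> R.
Proof.
rewrite exprzDr ?unitrN1// -exprz_exp.
have -> : (-1) ^ 2 = 1 :> R by rewrite -[LHS]/((-1) ^+ 2) sqrrN expr1n.
by rewrite exp1rz mulr1.
Qed.

Lemma checkerboard_sqr x : checkerboard x ^+ 2 = 1.
Proof.
rewrite /checkerboard expr2 -exprzDr ?unitrN1//.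
by rewrite -[RHS](signz2 0 (x.1.1 + x.1.2)); congr (_ ^ _); ring.
Qed.

(** A hop changes the parity of [m + n] exactly when its twist is even. The exponent is written as
    the multiple of [pi] that separates the phase at [(6 pi - g, pi / 8)] from the opposite of the
    phase at [(g, pi / 8)]. *)
Lemma checkerboard_step b x : checkerboard x * checkerboard (kagome_step b x) =
  (-1) ^ (1 + 3 * kagome_twist b x).
Proof.
rewrite /checkerboard -exprzDr ?unitrN1//.
case: x => -[m n]; elim/ord3P; case: b;
  cbn [fst snd kagome_step kagome_twist nat_of_ord ord3_0 ord3_1 ord3_2].
(* In each case the argument of [signz2] is half the difference of the two exponents. *)
- by rewrite -[RHS](signz2 _ (m + n)); congr (_ ^ _); ring.
- by rewrite -[RHS](signz2 _ (n - 2 * m - 2)); congr (_ ^ _); ring.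
- by rewrite -[RHS](signz2 _ (4 * m + n - 2)); congr (_ ^ _); ring.
- by rewrite -[RHS](signz2 _ (4 * m + n)); congr (_ ^ _); ring.
- by rewrite -[RHS](signz2 _ (m + n - 1)); congr (_ ^ _); ring.
- by rewrite -[RHS](signz2 _ (n - 2 * m - 1)); congr (_ ^ _); ring.
Qed.

Lemma expi_shift_pi (x y : R) (k : int) : y = x + pi * k%:~R ->
  expi y = ((-1) ^ k)%:C%C * expi x.
Proof. by move=> ->; rewrite expiD expi_pi_int mulrC. Qed.

Lemma sigma_real g w : sigma g w `<=` [set x%:C%C | x in `[-4, 4]%classic].
Proof. by rewrite /sigma Q_hopping; exact: spectrum_hopping. Qed.

Lemma sigmaD16pi g w : sigma (g + 16 * pi) w = sigma g w.
Proof.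
rewrite /sigma !Q_hopping; congr spectrum; apply: eq_hopping => b x.
(* With twist [L] the phase grows by [2 pi + 8 pi L], an even multiple of [pi], put in the shape of
   [signz2]. *)
rewrite (@expi_shift_pi (kagome_phase g w b x) _ (0 + 2 * (1 + 4 * kagome_twist b x))).
  by rewrite signz2 expr0z mul1r.
by rewrite /kagome_phase add0r !(intrM, intrD); field.
Qed.

Lemma sigmaD8pi g w z : sigma (g + 8 * pi) w z <-> sigma g w (- z).
Proof.
rewrite /sigma !Q_hopping.
rewrite (@hoppingN _ _ _ _ kagome_stepK kagome_backK (kagome_phase g w)).
  by apply: spectrumN => v; rewrite linearN.
move=> b x.
(* Here the phase grows by [pi + 4 pi L], an odd multiple of [pi]. *)
rewrite (@expi_shift_pi (kagome_phase g w b x) _ (1 + 2 * (2 * kagome_twist b x))).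
  by rewrite signz2 expr1z rmorphN mulN1r.
by rewrite /kagome_phase !(intrM, intrD); field.
Qed.

Lemma sigmaN0 g : sigma (- g) 0 = sigma g 0.
Proof.
rewrite /sigma !Q_hopping.
apply: (@spectrum_hopping_conj _ _ _ _ _ _ (fun=> 1)) => [x|b x].
  by rewrite expr1n.
by rewrite !mulr1 mul1r; congr expi; rewrite /kagome_phase; field.
Qed.

Lemma sigma6pi g : sigma (6 * pi - g) (pi / 8) = sigma g (pi / 8).
Proof.
rewrite /sigma !Q_hopping.
apply: (@spectrum_hopping_conj _ _ _ _ _ _ checkerboard) => [x|b x].
  exact: checkerboard_sqr.
rewrite checkerboard_step; apply: expi_shift_pi.
by rewrite /kagome_phase !(intrM, intrD); field.
Qed.

End kagome_hopping.

Theorem proposition1p11 (R : realType) :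
  (forall g w e : R,
    [/\ sigma g w `<=` [set x%:C%C | x in `[-4, 4]%classic],
        sigma (g + 16 * pi) w = sigma g w
      & sigma (g + 8 * pi) w e%:C%C <-> sigma g w (- e)%:C%C]) /\
  (forall g e : R,
    sigma (- g) 0 = sigma g 0 /\
    (sigma (8 * pi - g) 0 e%:C%C <-> sigma g 0 (- e)%:C%C)) /\
  (forall g e : R,
    sigma (6 * pi - g) (pi / 8) = sigma g (pi / 8) /\
    (sigma (- 2 * pi - g) (pi / 8) e%:C%C <-> sigma g (pi / 8) (- e)%:C%C)).
Proof.
split=> [g w e|]; first split; [exact: sigma_real|exact: sigmaD16pi| |].
  by rewrite rmorphN; exact: sigmaD8pi.
split=> g e; split; [exact: sigmaN0| |exact: sigma6pi|].
  (* The shift by [8 pi] starts from [- g], and [sigmaN0] replaces [- g] by [g]. *)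
  by rewrite addrC rmorphN -(sigmaN0 g); exact: sigmaD8pi.
(* The reflected parameter [6 pi - g] is the [8 pi] shift of [- 2 pi - g]. *)
rewrite -(sigma6pi g) (_ : 6 * pi - g = (- 2 * pi - g) + 8 * pi); last by ring.
by rewrite rmorphN sigmaD8pi opprK.
Qed.
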